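(* Let $p$ be a prime, let $n>0$ be an integer with $p^2\mid n$, and write $n=p^2m$. Let $R=\mathbb{Z}[\zeta_{pm}]$, where $\zeta_{pm}$ is a primitive $pm$-th root of unity, and let \[ G_2(\langle\zeta_{pm}\rangle)=\left\{\begin{pmatrix} d_1 & x\\ 0 & d_2\end{pmatrix} \;\middle|\; d_1,d_2\in\langle\zeta_{pm}\rangle,\ x\in R\right\}. \] Then the group $G_2(\langle\zeta_{pm}\rangle)$ satisfies a positive generalized identity of degree $n$, while every positive generalized identity satisfied by it has degree divisible by $n/p$. Consequently, the minimum degree of a positive generalized identity satisfied by $G_2(\langle\zeta_{pm}\rangle)$ is at least $n/p$.
   Context: For a group $G$ write $g^x=x^{-1}gx$. A group $G$ satisfies a positive generalized identity of degree $k\ge 1$ if there exist fixed elements $g_1,\dots,g_k\in G$ such that $x^{g_1}x^{g_2}\cdots x^{g_k}=1$ for all $x\in G$. $\langle\zeta_{pm}\rangle$ is the multiplicative cyclic group of order $pm$ generated by $\zeta_{pm}$. *)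

(* Defs.v *)
From HB Require Import structures.
From mathcomp Require Import all_boot all_order all_algebra all_field.
From mathcomp Require Import boolp.

Set Implicit Arguments.
Unset Strict Implicit.
Unset Printing Implicit Defensive.

Import GRing.Theory.

(* The product is ordered by increasing index, and x ^ y := y^-1 * (x * y). *)
Definition positive_generalized_identity (G : groupType) (k : nat) : Prop :=
  (0 < k)%N /\
  exists g : 'I_k -> G, forall x : G, (\prod_(i < k) x ^ g i = 1)%g.

Definition min_pgi_degree (G : groupType) (d : nat) : Prop :=
  positive_generalized_identity G d /\
  forall k, positive_generalized_identity G k -> (d <= k)%N.

Local Open Scope ring_scope.

(* Z[z], as a subset of the field algC of algebraic complex numbers. *)
Definition Zadjoin (z : algC) : {pred algC} :=
  [pred x | `[< exists q : {poly int}, x = (map_poly intr q).[z] >]].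

(* <z>, for z of multiplicative order N. *)
Definition root_powers (N : nat) (z : algC) : {pred algC} :=
  [pred d | [exists i : 'I_N, d == z ^+ i]].

Definition G2_pred (N : nat) (z : algC) : {pred 'M[algC]_2} :=
  [pred A : 'M[algC]_2 |
    [&& A 0 0 \in root_powers N z, A 1 1 \in root_powers N z,
        A 0 1 \in Zadjoin z & A 1 0 == 0]].

(* The proof that z is a primitive N-th root of unity is a parameter of the
   type, so that the group structure below can be inferred from the type. *)
Definition G2 (N : nat) (z : algC) (hz : N.-primitive_root z) : Type :=
  {A : 'M[algC]_2 | A \in G2_pred N z}.

Section G2Group.
Variables (N : nat) (z : algC).

Lemma ZadjoinP x :
  reflect (exists q : {poly int}, x = (map_poly intr q).[z]) (x \in Zadjoin z).
Proof. exact: asboolP. Qed.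

Lemma Zadjoin0 : 0 \in Zadjoin z.
Proof. by apply/ZadjoinP; exists 0; rewrite rmorph0 horner0. Qed.

Lemma ZadjoinD x y :
  x \in Zadjoin z -> y \in Zadjoin z -> x + y \in Zadjoin z.
Proof.
move=> /ZadjoinP[p ->] /ZadjoinP[q ->]; apply/ZadjoinP; exists (p + q).
by rewrite rmorphD hornerD.
Qed.

Lemma ZadjoinN x : x \in Zadjoin z -> - x \in Zadjoin z.
Proof.
move=> /ZadjoinP[p ->]; apply/ZadjoinP; exists (- p).
by rewrite rmorphN hornerN.
Qed.

Lemma ZadjoinM x y :
  x \in Zadjoin z -> y \in Zadjoin z -> x * y \in Zadjoin z.
Proof.
move=> /ZadjoinP[p ->] /ZadjoinP[q ->]; apply/ZadjoinP; exists (p * q).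
by rewrite rmorphM hornerM.
Qed.

Lemma root_powers_Zadjoin d : d \in root_powers N z -> d \in Zadjoin z.
Proof.
move=> /existsP[i /eqP->]; apply/ZadjoinP; exists 'X^i.
by rewrite map_polyXn hornerXn.
Qed.

Hypothesis hz : N.-primitive_root z.

Lemma root_powersX k : z ^+ k \in root_powers N z.
Proof.
have N0 := prim_order_gt0 hz.
apply/existsP; exists (Ordinal (ltn_pmod k N0)) => /=.
by rewrite (prim_expr_mod hz).
Qed.

Lemma root_powers1 : 1 \in root_powers N z.
Proof. exact: (root_powersX 0). Qed.

Lemma root_powersM c d :
  c \in root_powers N z -> d \in root_powers N z -> c * d \in root_powers N z.
Proof.
by move=> /existsP[i /eqP->] /existsP[j /eqP->]; rewrite -exprD root_powersX.
Qed.

Lemma root_powersV d :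
  d \in root_powers N z -> d != 0 /\ d^-1 \in root_powers N z.
Proof.
move=> /existsP[i /eqP->].
have e : z ^+ i * z ^+ (N - i) = 1.
  by rewrite -exprD subnKC ?(prim_expr_order hz) // ltnW.
have nz : z ^+ i != 0.
  by apply: contra_eq_neq e => ->; rewrite mul0r eq_sym oner_neq0.
split=> //; suff -> : (z ^+ i)^-1 = z ^+ (N - i) by exact: root_powersX.
by rewrite -[LHS]mulr1 -e mulKf.
Qed.

Lemma mulmx22E (A B : 'M[algC]_2) i j :
  (A * B) i j = A i 0 * B 0 j + A i 1 * B 1 j.
Proof.
rewrite mxE !big_ord_recl big_ord0 addr0.
by have -> : lift ord0 ord0 = 1 :> 'I_2 by exact: val_inj.
Qed.

Lemma G2_pred1 : 1 \in G2_pred N z.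
Proof. by apply/and4P; rewrite !mxE root_powers1 Zadjoin0. Qed.

Lemma G2_predM A B :
  A \in G2_pred N z -> B \in G2_pred N z -> A * B \in G2_pred N z.
Proof.
move=> /and4P[a1 a2 ax /eqP a0] /and4P[b1 b2 bx /eqP b0].
apply/and4P; rewrite !mulmx22E a0 b0 !(mulr0, mul0r, addr0, add0r) eqxx.
split; rewrite ?root_powersM //.
by apply: ZadjoinD; apply: ZadjoinM => //; exact: root_powers_Zadjoin.
Qed.

Lemma G2_predV A : A \in G2_pred N z ->
  A \is a GRing.unit /\ A^-1 \in G2_pred N z.
Proof.
move=> /and4P[a1 a2 ax /eqP a0].
have [n1 v1] := root_powersV a1; have [n2 v2] := root_powersV a2.
pose B : 'M[algC]_2 := \matrix_(i, j)
  if i == 0 then if j == 0 then (A 0 0)^-1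
                 else - ((A 0 0)^-1 * A 0 1 * (A 1 1)^-1)
  else if j == 0 then 0 else (A 1 1)^-1.
have ord2 (i : 'I_2) : i = 0 \/ i = 1.
  by case: i => [[|[|i]] //= hi]; [left | right]; exact: val_inj.
have AB : A * B = 1.
  apply/matrixP=> i j; rewrite mulmx22E !mxE /=.
  case: (ord2 i) => ->; case: (ord2 j) => -> /=; rewrite ?a0.
  - by rewrite divff // mulr0 addr0.
  - by rewrite mulrN -!mulrA mulVKf // addNr.
  - by rewrite mul0r mulr0 addr0.
  - by rewrite mul0r add0r divff.
have uA : A \is a GRing.unit by have [] := mulmx1_unit AB.
split=> //; suff -> : A^-1 = B.
  apply/and4P; rewrite !mxE /=; split=> //.
  apply: ZadjoinN; apply: ZadjoinM; last exact: root_powers_Zadjoin.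
  by apply: ZadjoinM => //; exact: root_powers_Zadjoin.
by rewrite -[LHS]mulr1 -AB mulKr.
Qed.

HB.instance Definition _ := Choice.on (G2 hz).

Definition G2_one : G2 hz := Sub 1 G2_pred1.
Definition G2_mul (A B : G2 hz) : G2 hz :=
  Sub (val A * val B) (G2_predM (valP A) (valP B)).
Definition G2_inv (A : G2 hz) : G2 hz :=
  Sub (val A)^-1 (proj2 (G2_predV (valP A))).

Lemma G2_mulA : associative G2_mul.
Proof. by move=> A B C; apply: val_inj; rewrite /= mulrA. Qed.
Lemma G2_mul1 : left_id G2_one G2_mul.
Proof. by move=> A; apply: val_inj; rewrite /= mul1r. Qed.
Lemma G2_mulr1 : right_id G2_one G2_mul.
Proof. by move=> A; apply: val_inj; rewrite /= mulr1. Qed.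
Lemma G2_mulV : left_inverse G2_one G2_inv G2_mul.
Proof.
by move=> A; apply: val_inj; rewrite /= mulVr //; have [] := G2_predV (valP A).
Qed.
Lemma G2_mulrV : right_inverse G2_one G2_inv G2_mul.
Proof.
by move=> A; apply: val_inj; rewrite /= mulrV //; have [] := G2_predV (valP A).
Qed.

HB.instance Definition _ :=
  isGroup.Build (G2 hz) G2_mulA G2_mul1 G2_mulr1 G2_mulV G2_mulrV.

End G2Group.

(* Main.v *)
Require Import Defs.
From HB Require Import structures.
From mathcomp Require Import all_boot all_order all_algebra all_field.
From mathcomp Require Import boolp.

(** An upper triangular x with diagonal (a, b) and corner u is turned by
    conjugation with diag(1, r) into the matrix with the same diagonal and
    corner u r.  The corner of the product of the conjugates by
    diag(1, r_0), ..., diag(1, r_{n-1}) is therefore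
    u * \sum_i a^i b^(n-1-i) r_i.  As a and b are pm-th roots of unity,
    a^i b^(n-1-i) only depends on i modulo pm, so it suffices that the p values
    r_i in each residue class modulo pm sum to 0: take r_i = w^(i / pm) with
    w = z^m of order p.  In the other direction every conjugate of z%:M has
    diagonal (z, z), so a degree k forces z^k = 1. *)

Set Implicit Arguments.
Unset Strict Implicit.
Unset Printing Implicit Defensive.

Import GRing.Theory.

Local Open Scope ring_scope.

(** Appending a factor multiplies the old corner by [b] and adds [a ^+ k] times the new corner, so
    term [i] collects one [b] for each of the [k - i.+1] later factors. *)
Lemma prod_triangular_mx22 (a b : algC) (A : nat -> 'M[algC]_2) k :
    (forall i, [/\ A i 0 0 = a, A i 1 1 = b & A i 1 0 = 0]) ->
  let P := \prod_(i < k) A i in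
  [/\ P 0 0 = a ^+ k, P 1 1 = b ^+ k, P 1 0 = 0 &
      P 0 1 = \sum_(i < k) a ^+ i * A i 0 1 * b ^+ (k - i.+1)].
Proof.
move=> hA /=; elim: k => [|k [IH0 IH1 IH10 IH01]].
  by rewrite !big_ord0 !mxE.
have [h0 h1 h10] := hA k.
rewrite !big_ord_recr /= !mulmx22E IH0 IH1 IH10 IH01 h0 h1 h10.
rewrite !(mulr0, mul0r, addr0, add0r) -!exprSr subnn mulr1; split=> //.
rewrite addrC; congr (_ + _); rewrite mulr_suml; apply: eq_bigr => i _.
by rewrite -mulrA -exprSr subSn.
Qed.

Lemma sum_expr_unity (F : fieldType) (w : F) p :
  w ^+ p = 1 -> w != 1 -> \sum_(i < p) w ^+ i = 0.
Proof.
move=> wp w1; apply/eqP; have /eqP := subrX1 w p.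
by rewrite wp subrr eq_sym mulf_eq0 subr_eq0 (negPf w1).
Qed.

(** Writing i = l * N + j separates the variables: the sum factors, and its factor in l is a
    vanishing geometric sum. *)
Lemma sum_periodic_expr_unity (F : fieldType) (w : F) p N (f : nat -> F) :
    w ^+ p = 1 -> w != 1 -> (0 < N)%N -> (forall i, f (i %% N)%N = f i) ->
  \sum_(i < p * N) f i * w ^+ (i %/ N)%N = 0.
Proof.
move=> wp w1 N0 fN.
(* The number of blocks is freed from [p] to allow induction on it. *)
have -> k : \sum_(i < k * N) f i * w ^+ (i %/ N)%N
    = (\sum_(j < N) f j) * \sum_(l < k) w ^+ l.
  elim: k => [|k IH]; first by rewrite mul0n !big_ord0 mulr0.
  rewrite mulSnr big_split_ord /= IH big_ord_recr /= mulrDr; congr (_ + _).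
  rewrite mulr_suml; apply: eq_bigr => j _.
  by rewrite divnMDl // divn_small // addn0 -fN modnMDl fN.
by rewrite sum_expr_unity ?mulr0.
Qed.

Section G2Theory.
Variables (N : nat) (z : algC) (hz : N.-primitive_root z).
Implicit Types x g : G2 hz.

Lemma root_powers_unity d : d \in root_powers N z -> d ^+ N = 1.
Proof. by move=> /existsP[i /eqP->]; rewrite exprAC (prim_expr_order hz) expr1n. Qed.

Lemma G2_val_prod (I : Type) (r : seq I) (P : pred I) (F : I -> G2 hz) :
  val (\prod_(i <- r | P i) F i)%g = \prod_(i <- r | P i) val (F i).
Proof. by apply: (big_morph val). Qed.

(** Comparing entries in g Y = x g avoids computing the inverse of g; this is why the corner of Y is
    given only by an equation. *)
Lemma G2_val_conj x g (Y := val (x ^ g)%g) :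
  [/\ Y 0 0 = val x 0 0, Y 1 1 = val x 1 1, Y 1 0 = 0 &
      val g 0 0 * Y 0 1 + val g 0 1 * val x 1 1 =
      val x 0 0 * val g 0 1 + val x 0 1 * val g 1 1].
Proof.
have [ug _] := G2_predV hz (valP g).
have /and4P[g0 g1 _ /eqP g10] := valP g.
have [[nz0 _] [nz1 _]] := (root_powersV hz g0, root_powersV hz g1).
have /and4P[_ _ _ /eqP x10] := valP x.
have /and4P[_ _ _ /eqP] := valP (x ^ g)%g; rewrite -/Y => Y10.
have gY : val g * Y = val x * val g.
  have -> : Y = (val g)^-1 * (val x * val g) by [].
  by rewrite mulVKr.
clearbody Y; have E i j := congr1 (fun M : 'M_2 => M i j) gY.
have := E 0 0; have := E 1 1; have := E 0 1.
rewrite /= !mulmx22E g10 Y10 x10 !(mulr0, mul0r, addr0, add0r) => e01 e11 e00.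
have Y11 : Y 1 1 = val x 1 1 by apply: (mulfI nz1); rewrite e11 mulrC.
split=> //; first by apply: (mulfI nz0); rewrite e00 mulrC.
by rewrite -e01 Y11.
Qed.

Definition diag_mx22 (d1 d2 : algC) : 'M[algC]_2 :=
  \matrix_(i, j) if i == j then if i == 0 then d1 else d2 else 0.

Lemma diag_mx22_G2 d1 d2 :
    d1 \in root_powers N z -> d2 \in root_powers N z ->
  diag_mx22 d1 d2 \in G2_pred N z.
Proof. by move=> h1 h2; apply/and4P; rewrite !mxE /= h1 h2 Zadjoin0. Qed.

Definition G2_diag d1 d2 (h1 : d1 \in root_powers N z)
    (h2 : d2 \in root_powers N z) : G2 hz :=
  Sub (diag_mx22 d1 d2) (diag_mx22_G2 h1 h2).

Lemma G2_prod_conj x (g : nat -> G2 hz) k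
    (P := val (\prod_(i < k) x ^ g i)%g) :
  [/\ P 0 0 = val x 0 0 ^+ k, P 1 1 = val x 1 1 ^+ k, P 1 0 = 0 &
      P 0 1 = \sum_(i < k) val x 0 0 ^+ i * val (x ^ g i)%g 0 1
                             * val x 1 1 ^+ (k - i.+1)].
Proof.
rewrite /P G2_val_prod.
apply: (prod_triangular_mx22 (A := fun i => val (x ^ g i)%g)) => i.
by have [] := G2_val_conj x (g i).
Qed.

Lemma pgi_degree_dvd k : positive_generalized_identity (G2 hz) k -> (N %| k)%N.
Proof.
case=> k0 [g hg].
pose x := G2_diag (root_powersX hz 1) (root_powersX hz 1).
(* [inord] needs a successor bound to extend the family [g] to all naturals. *)
case: k k0 g hg => // k _ g /(_ x) xg.
have [P00 _ _ _] := G2_prod_conj x (fun i => g (inord i)) k.+1.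
rewrite (prim_order_dvd hz); apply/eqP.
move: P00; under eq_bigr do rewrite inord_val.
by rewrite xg !mxE /= expr1 => <-.
Qed.

Lemma pgi_of_unity_order p w : (0 < p)%N ->
    w \in root_powers N z -> w ^+ p = 1 -> w != 1 ->
  positive_generalized_identity (G2 hz) (p * N).
Proof.
move=> p0 wN wp w1; have N0 := prim_order_gt0 hz.
have rN i : w ^+ i \in root_powers N z.
  by move: wN => /existsP[j /eqP->]; rewrite -exprM root_powersX.
split; first by rewrite muln_gt0 p0.
pose g i := G2_diag (root_powers1 hz) (rN (i %/ N)%N).
exists (fun i => g i) => x.
have [P00 P11 P10 P01] := G2_prod_conj x g (p * N).
have /and4P[/root_powers_unity aN bN _ _] := valP x.
have [b0 _] := root_powersV hz bN; move/root_powers_unity: bN => bN.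
move: P00 P11 P10 P01; set P := (\prod_(i < _) _)%g.
set a := val x 0 0 in aN *; set b := val x 1 1 in bN b0 *.
rewrite (mulnC p) !exprM aN bN !expr1n (mulnC N) => P00 P11 P10 P01.
have {}P01 : val P 0 1 = 0.
  (* As b ^ (p N) = 1, the power of [b] is an inverse; this removes the truncated subtraction and
     makes the coefficient visibly N-periodic in i. *)
  pose f i := a ^+ i * val x 0 1 * (b ^+ i.+1)^-1.
  rewrite P01 -[RHS](sum_periodic_expr_unity (f := f) wp w1 N0); last first.
    by move=> i; rewrite /f !exprSr (expr_mod _ aN) (expr_mod _ bN).
  apply: eq_bigr => i _.
  have [_ _ _] := G2_val_conj x (g i).
  rewrite !mxE /= mul1r mul0r addr0 mulr0 add0r => ->.
  have -> : b ^+ (p * N - i.+1) = (b ^+ i.+1)^-1.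
    apply: (mulIf (expf_neq0 i.+1 b0)).
    by rewrite mulVf ?expf_neq0 // -exprD subnK // mulnC exprM bN expr1n.
  by rewrite /f mulrA mulrAC.
apply: val_inj; apply/matrixP=> i j; rewrite [RHS]mxE.
by case: i => [[|[|i]] //= hi]; case: j => [[|[|j]] //= hj];
  [rewrite -[RHS]P00 | rewrite -[RHS]P01 | rewrite -[RHS]P10 | rewrite -[RHS]P11];
  congr (val P _ _); exact: val_inj.
Qed.

End G2Theory.

(** Well-ordering of the naturals, with the predicate made boolean classically. *)
Lemma min_pgi_degree_exists (G : groupType) k :
  positive_generalized_identity G k -> exists d, min_pgi_degree G d.
Proof.
move=> hk; have ex : exists k, `[< positive_generalized_identity G k >].
  by exists k; apply/asboolP.
have [d /asboolP hd dmin] := ex_minnP ex.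
by exists d; split=> // j hj; apply: dmin; apply/asboolP.
Qed.

Local Close Scope ring_scope.

Theorem mainTheorem6 (p m n : nat) (z : algC)
    (hp : prime p) (hn : (0 < n)%N) (hnm : n = (p ^ 2 * m)%N)
    (hz : (p * m)%N.-primitive_root%R z) :
  [/\ positive_generalized_identity (G2 hz) n,
      forall k : nat, positive_generalized_identity (G2 hz) k ->
        (n %/ p %| k)%N
    & exists2 d : nat, min_pgi_degree (G2 hz) d & (n %/ p <= d)%N].
Proof.
have p0 := prime_gt0 hp.
have n_eq : n = p * (p * m) by rewrite hnm mulnA.
have m0 : 0 < m by move: hn; rewrite hnm muln_gt0 => /andP[].
rewrite n_eq mulKn //.
have pgi : positive_generalized_identity (G2 hz) (p * (p * m)).
  apply: (@pgi_of_unity_order _ _ hz p (z ^+ m)%R); rewrite ?root_powersX //.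
    by rewrite -exprM mulnC (prim_expr_order hz).
  (* If z ^ m = 1, then p m divides m > 0, which forces p <= 1. *)
  rewrite -(prim_order_dvd hz); apply: contraL (prime_gt1 hp) => /(dvdn_leq m0).
  by rewrite -leqNgt -{2}[m]mul1n leq_pmul2r.
split=> //; first exact: pgi_degree_dvd.
have [d hd] := min_pgi_degree_exists pgi.
exists d => //; have [hd0 _] := hd.
(* Divisibility bounds [d] from below because degrees are positive. *)
by apply: dvdn_leq (pgi_degree_dvd hd0); case: hd0.
Qed.
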